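(* (Rice theorem for recursive presentations) There is no non-trivial decidable marked group property for groups given by recursive presentations.
   Context: For a natural number $k$, a $k$-marked group is a pair $(G,S)$ where $G$ is a group and $S=(s_1,\dots,s_k)\in G^k$ is a tuple of elements that generates $G$. A morphism of $k$-marked groups $(G,S)\to(H,S')$ is a group morphism from $G$ to $H$ that maps $S$ to $S'$ respecting the order; it is an isomorphism if the underlying group morphism is a group isomorphism. Marked groups are considered up to isomorphism of marked groups. $\mathcal{G}_k$ is the set of isomorphism classes of $k$-marked groups, and $\mathcal{G}$, the set of isomorphism classes of marked groups, is the disjoint union of the sets $\mathcal{G}_k$ over all $k$. A marked group property is a subset of $\mathcal{G}$. Let $\langle n,m\rangle$ denote a computable bijection $\mathbb{N}^2\to\mathbb{N}$ with computable inverse. Let $\mathcal{A}_n=\{x_1,\dots,x_n\}$, let $\mathcal{A}_n^{-1}=\{x_1^{-1},\dots,x_n^{-1}\}$ be formal inverses, and let $\theta_n:\mathbb{N}\to(\mathcal{A}_n\cup\mathcal{A}_n^{-1})^*$ be a natural bijection onto the set of words (for instance, ordering words by the shortlex order). Let $\varphi_0,\varphi_1,\dots$ be the standard enumeration of the partial computable functions and $W_i=\mathrm{dom}(\varphi_i)$. The numbering associated to recursive presentations is $\nu_{RP}(\langle n,i\rangle)=\langle\mathcal{A}_n\mid\theta_n(W_i)\rangle$, the group being marked by $(x_1,\dots,x_n)$; here both $n$ and $i$ vary. A marked group is given by a recursive presentation when it is given by a $\nu_{RP}$-name, i.e. a number $p$ such that $\nu_{RP}(p)$ is this marked group, and it is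 recursively presented if it has such a name. A marked group property $P$ is semi-decidable from recursive presentations if there is an algorithm that, given a $\nu_{RP}$-name of a marked group, stops if and only if this marked group belongs to $P$. It is decidable for groups given by recursive presentations if both $P$ and its complement are semi-decidable from recursive presentations. It is non-trivial if some recursively presented marked group belongs to it and some recursively presented marked group does not.
   Formalization: Non-triviality is required among marked groups with a fixed number k of generators (any k): read literally the claim is false, since ''at most one generator'' is a non-trivial marked group property decidable from recursive presentations. *)

(* Defs.v *)
From HB Require Import structures.
From mathcomp Require Import all_boot.
From mathcomp Require Import boolp classical_sets.
From Stdlib Require Cantor.

Set Implicit Arguments.
Unset Strict Implicit.
Unset Printing Implicit Defensive.

Import Algebra.

Definition pair_nat (x y : nat) : nat := Cantor.to_nat (x, y).
Arguments pair_nat : simpl never.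

Notation "<< x , y >>" := (pair_nat x y) (format "<< x ,  y >>").

(* Programs for the partial recursive functions of one variable; several
   arguments are passed through the Cantor pairing. *)
Inductive code :=
| Zero | Succ | Fst | Snd
| Pair of code & code
| Comp of code & code
| Rec of code & code
| Min of code.

(* [eval c x y]: the program c halts on input x with output y.
   [Rec c d] is primitive recursion on the second component of the input, and
   [Min c] maps x to the least y such that c outputs 0 on <<x, y>>, c having
   to halt on <<x, z>> for all z < y. *)
Fixpoint eval (c : code) : nat -> nat -> Prop :=
  match c with
  | Zero => fun _ y => y = 0
  | Succ => fun x y => y = x.+1
  | Fst => fun x y => y = (Cantor.of_nat x).1
  | Snd => fun x y => y = (Cantor.of_nat x).2
  | Pair c d => fun x y =>
      exists u v, [/\ eval c x u, eval d x v & y = <<u, v>>]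
  | Comp c d => fun x y => exists2 u, eval d x u & eval c u y
  | Rec c d => fun x =>
      let a := (Cantor.of_nat x).1 in
      (fix iter n : nat -> Prop :=
         match n with
         | 0 => eval c a
         | m.+1 => fun y => exists2 r, iter m r & eval d <<a, <<m, r>>>> y
         end) (Cantor.of_nat x).2
  | Min c => fun x y =>
      eval c <<x, y>> 0 /\ forall z, z < y -> exists r, eval c <<x, z>> r.+1
  end.

(* The fuel n suffices for [decode n], see [decode_bij]. *)
Fixpoint decode_rec (fuel n : nat) : code :=
  match fuel, n with
  | 0, _ | _, 0 => Zero
  | _, 1 => Succ
  | _, 2 => Fst
  | _, 3 => Snd
  | f.+1, k.+4 =>
      let m := k %/ 4 in
      let c := decode_rec f (Cantor.of_nat m).1 in
      let d := decode_rec f (Cantor.of_nat m).2 in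
      match k %% 4 with
      | 0 => Pair c d
      | 1 => Comp c d
      | 2 => Rec c d
      | _ => Min (decode_rec f m)
      end
  end.

Definition decode (n : nat) : code := decode_rec n n.

Definition phi (i : nat) : nat -> nat -> Prop := eval (decode i).

Definition W (i : nat) : set nat := [set x | exists y, phi i x y].

Fixpoint encode (c : code) : nat :=
  match c with
  | Zero => 0
  | Succ => 1
  | Fst => 2
  | Snd => 3
  | Pair c d => (<<encode c, encode d>> * 4).+4
  | Comp c d => (<<encode c, encode d>> * 4 + 1).+4
  | Rec c d => (<<encode c, encode d>> * 4 + 2).+4
  | Min c => (encode c * 4 + 3).+4
  end.

Lemma pair_ge x y : (x <= <<x, y>>) && (y <= <<x, y>>).
Proof.
rewrite /pair_nat; have /leP := Cantor.to_nat_non_decreasing x y; rewrite plusE => h.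
by rewrite (leq_trans (leq_addl _ _) h) (leq_trans (leq_addr _ _) h).
Qed.

Lemma pair_natK x y : Cantor.of_nat <<x, y>> = (x, y).
Proof. exact: Cantor.cancel_of_to. Qed.

Lemma decode_bij : bijective decode.
Proof.
have dM m r : r < 4 -> (m * 4 + r) %/ 4 = m /\ (m * 4 + r) %% 4 = r.
  by move=> h; rewrite divnMDl // divn_small // addn0 modnMDl modn_small.
have enc_dec f n : n <= f -> encode (decode_rec f n) = n.
  elim: f n => [|f IH] [|[|[|[|k]]]] //=.
  rewrite !ltnS => lekf.
  have {lekf} lef : k %/ 4 <= f.
    by apply: leq_trans (leq_div _ _) _; apply: leq_trans lekf; rewrite -addn3 leq_addr.
  have em : <<(Cantor.of_nat (k %/ 4)).1, (Cantor.of_nat (k %/ 4)).2>> = k %/ 4.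
    by rewrite /pair_nat -surjective_pairing Cantor.cancel_to_of.
  have /andP[le1 le2] :=
    pair_ge (Cantor.of_nat (k %/ 4)).1 (Cantor.of_nat (k %/ 4)).2.
  rewrite em in le1 le2.
  have := ltn_pmod k (isT : 0 < 4); have := divn_eq k 4.
  set m := k %/ 4 in lef em le1 le2 *.
  have IH1 := IH _ (leq_trans le1 lef); have IH2 := IH _ (leq_trans le2 lef).
  case: (k %% 4) => [|[|[|[|r]]]] // -> _ /=;
    by rewrite ?IH1 ?IH2 ?IH // ?em // addn0.
have dec_enc c f : encode c <= f -> decode_rec f (encode c) = c.
  have le4 e r g : (e * 4 + r).+4 <= g.+1 -> e <= g.
    rewrite ltnS; apply: leq_trans; do 3!apply: leqW.
    by apply: leq_trans (leq_addr r _); rewrite leq_pmulr.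
  elim: c f => [||||c IHc d IHd|c IHc d IHd|c IHc d IHd|c IHc] [|f] //.
  - rewrite [encode _]/= -[_ * 4]addn0 => /le4 lef /=.
    have [-> ->] := dM <<encode c, encode d>> 0 isT.
    have /andP[le1 le2] := pair_ge (encode c) (encode d).
    by rewrite pair_natK /= IHc ?IHd ?(leq_trans le1) ?(leq_trans le2).
  - rewrite [encode _]/= => /le4 lef /=.
    have [-> ->] := dM <<encode c, encode d>> 1 isT.
    have /andP[le1 le2] := pair_ge (encode c) (encode d).
    by rewrite pair_natK /= IHc ?IHd ?(leq_trans le1) ?(leq_trans le2).
  - rewrite [encode _]/= => /le4 lef /=.
    have [-> ->] := dM <<encode c, encode d>> 2 isT.
    have /andP[le1 le2] := pair_ge (encode c) (encode d).
    by rewrite pair_natK /= IHc ?IHd ?(leq_trans le1) ?(leq_trans le2).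
  - rewrite [encode _]/= => /le4 lef /=.
    have [-> ->] := dM (encode c) 3 isT.
    by rewrite IHc.
by exists encode => [n|c]; [apply: enc_dec|apply: dec_enc].
Qed.

(* [inl i] is the generator x_i and [inr i] its formal inverse. *)
Definition letter (n : nat) := ('I_n + 'I_n)%type.
Definition word (n : nat) := seq (letter n).

Definition letter_inv (n : nat) (a : letter n) : letter n :=
  match a with inl i => inr i | inr i => inl i end.

Definition word_inv (n : nat) (w : word n) : word n :=
  rev [seq letter_inv a | a <- w].

(* Shortlex enumeration of the words over letters numbered 0, ..., b - 1, i.e.
   bijective numeration in base b. *)
Fixpoint shortlex (T : Type) (b : nat) (l : nat -> T) (fuel m : nat) : seq T :=
  match fuel, m with
  | f.+1, m'.+1 => rcons (shortlex b l f (m' %/ b)) (l (m' %% b))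
  | _, _ => [::]
  end.

(* The letters are ordered as x_1, ..., x_n, x_1^-1, ..., x_n^-1. For n = 0 the
   only word is the empty one, so theta cannot be a bijection. *)
Definition theta (n : nat) : nat -> word n :=
  match n with
  | 0 => fun _ => [::]
  | n'.+1 => fun m =>
      shortlex (n'.+1 + n'.+1) (fun r => @split n'.+1 n'.+1 (inord r)) m m
  end.

Lemma theta_bij (n : nat) : 0 < n -> bijective (@theta n).
Proof.
case: n => // n _; set b := n.+1 + n.+1.
pose idx : word n.+1 -> nat := foldl (fun m a => (m * b + unsplit a).+1) 0.
have idx_rcons w a : idx (rcons w a) = (idx w * b + unsplit a).+1.
  by rewrite /idx foldl_rcons.
exists idx => [m|w]; rewrite /theta -/b.
  suff H f : m <= f ->
    idx (shortlex b (fun r => @split n.+1 n.+1 (inord r)) f m) = m by exact: H.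
  elim: f m => [|f IH] [|m] //= lemf.
  rewrite idx_rcons IH ?(leq_trans (leq_div _ _)) //.
  by rewrite splitK inordK ?ltn_mod // -divn_eq.
suff H f : idx w <= f ->
    shortlex b (fun r => @split n.+1 n.+1 (inord r)) f (idx w) = w by exact: H.
elim/last_ind: w f => [|w a IH] [|f] //; rewrite idx_rcons //= ltnS => lef.
have lta : unsplit a < b by exact: ltn_ord.
rewrite divnMDl // divn_small // addn0 modnMDl modn_small // inord_val unsplitK.
rewrite IH //; apply: leq_trans lef; apply: leq_trans (leq_addr _ _).
by rewrite leq_pmulr.
Qed.

Section Presentation.
Variables (n : nat) (R : set (word n)).

(* Two words are related when they represent the same element of the group
   presented by the generators x_1, ..., x_n and the relators in R. *)
Inductive pres_eq : word n -> word n -> Prop :=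
| pres_refl u : pres_eq u u
| pres_sym u v : pres_eq u v -> pres_eq v u
| pres_trans u v w : pres_eq u v -> pres_eq v w -> pres_eq u w
| pres_cat u u' v v' :
    pres_eq u u' -> pres_eq v v' -> pres_eq (u ++ v) (u' ++ v')
| pres_cancel a : pres_eq [:: a; letter_inv a] [::]
| pres_relator r : R r -> pres_eq r [::].

Definition pres_rel : rel (word n) := fun u v => `[< pres_eq u v >].

Lemma pres_rel_equiv : equiv_class_of pres_rel.
Proof.
split=> [u|u v|v u w]; first by apply/asboolP; apply: pres_refl.
  by apply/asboolP/asboolP; apply: pres_sym.
by move=> /asboolP h1 /asboolP h2; apply/asboolP; apply: pres_trans h2.
Qed.

Canonical pres_equiv := EquivRelPack pres_rel_equiv.

Local Open Scope quotient_scope.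

Definition presented : Type := {eq_quot pres_equiv}.
HB.instance Definition _ := Choice.on presented.
HB.instance Definition _ := EqQuotient.on presented.

Lemma pres_eqP (u v : word n) : pres_eq u v <-> u = v %[mod presented].
Proof.
by split=> [h|/eqmodP/asboolP//]; apply/eqmodP; apply/asboolP.
Qed.

Definition pres_one : presented := \pi_presented [::].
Definition pres_mul (x y : presented) : presented :=
  \pi_presented (repr x ++ repr y).
Definition pres_inv (x : presented) : presented :=
  \pi_presented (word_inv (repr x)).

Lemma pi_mul (u v : word n) :
  pres_mul (\pi_presented u) (\pi_presented v) = \pi_presented (u ++ v).
Proof. by apply/pres_eqP; apply: pres_cat; apply/pres_eqP; rewrite reprK. Qed.

Lemma pres_mulVw (w : word n) : pres_eq (word_inv w ++ w) [::].
Proof.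
elim: w => [|a w IH]; first exact: pres_refl.
rewrite /word_inv /= rev_cons cat_rcons -cat1s -[a :: w]cat1s.
apply: pres_trans IH; apply: pres_cat; first exact: pres_refl.
rewrite catA -[w in X in pres_eq _ X]cat0s.
apply: pres_cat; last exact: pres_refl.
by case: a => i; [apply: (pres_cancel (inr i))|apply: (pres_cancel (inl i))].
Qed.

Lemma pres_mulA : associative pres_mul.
Proof.
move=> x y z; rewrite -[x]reprK -[y]reprK -[z]reprK.
by rewrite (pi_mul (repr y)) (pi_mul (repr x) (repr y)) !pi_mul catA.
Qed.
Lemma pres_mul1 : left_id pres_one pres_mul.
Proof. by move=> x; rewrite -[x]reprK pi_mul. Qed.
Lemma pres_mulr1 : right_id pres_one pres_mul.
Proof. by move=> x; rewrite -[x]reprK pi_mul cats0. Qed.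
Lemma pres_mulV : left_inverse pres_one pres_inv pres_mul.
Proof.
by move=> x; rewrite -{2}[x]reprK pi_mul; apply/pres_eqP; apply: pres_mulVw.
Qed.
Lemma pres_mulrV : right_inverse pres_one pres_inv pres_mul.
Proof.
move=> x; rewrite -[LHS]pres_mul1 -{1}(pres_mulV (pres_inv x)) -pres_mulA.
by rewrite [pres_mul (pres_inv x) _]pres_mulA pres_mulV pres_mul1 pres_mulV.
Qed.

HB.instance Definition _ :=
  isGroup.Build presented pres_mulA pres_mul1 pres_mulr1 pres_mulV pres_mulrV.
End Presentation.

Definition generates (G : groupType) (S : seq G) : Prop :=
  forall H : {pred G}, group_closed H -> {subset S <= H} -> H =i predT.

(* The marking is the tuple (s_1, ..., s_k), as a list, so that this type is the
   disjoint union over k of the k-marked groups. *)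
Record marked_group := MarkedGroup {
  carrier :> groupType;
  marking : seq carrier;
  marking_generates : generates marking
}.

Definition rank (M : marked_group) : nat := size (marking M).

Definition marked_iso (M N : marked_group) : Prop :=
  exists2 f : {multiplicative M -> N},
    bijective f & [seq f s | s <- marking M] = marking N.

(* A property is a set of isomorphism classes. *)
Definition marked_group_property (P : marked_group -> Prop) : Prop :=
  forall M N, marked_iso M N -> (P M <-> P N).

Section MarkedPresentation.
Variables (n : nat) (R : set (word n)).

Definition generators : seq (presented R) :=
  [seq (\pi_(presented R) [:: inl i])%qT | i <- enum 'I_n].

Lemma generators_generate : generates generators.
Proof.
move=> H closedH genH x; rewrite -[x]reprK [RHS]inE.
have [H1 _] := closedH.
have Hg i : (\pi_(presented R) [:: inl i])%qT \in H.
  by apply: genH; apply: map_f; rewrite mem_enum.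
have pi_cat u v : (\pi_(presented R) (u ++ v))%qT
    = ((\pi_(presented R) u)%qT * (\pi_(presented R) v)%qT)%g.
  by rewrite -[RHS]/(pres_mul _ _) pi_mul.
elim: (repr x) => [|a w IH]; first exact: H1.
rewrite -cat1s pi_cat; apply: group_closedM => //; case: a => i //.
suff -> : (\pi_(presented R) [:: inr i])%qT
    = ((\pi_(presented R) [:: inl i])%qT^-1)%g by exact: group_closedV.
apply: (mulgI (\pi_(presented R) [:: inl i])%qT); rewrite mulgV -pi_cat.
by apply/pres_eqP; apply: (pres_cancel _ (inl i)).
Qed.

Definition presentation : marked_group := MarkedGroup generators_generate.
End MarkedPresentation.

Definition nu_RP (p : nat) : marked_group :=
  let: (n, i) := Cantor.of_nat p in presentation (@theta n @` W i).

Definition recursively_presented (M : marked_group) : Prop :=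
  exists p, marked_iso (nu_RP p) M.

Definition semi_decidable_RP (P : marked_group -> Prop) : Prop :=
  exists i, forall p, W i p <-> P (nu_RP p).

Definition decidable_RP (P : marked_group -> Prop) : Prop :=
  semi_decidable_RP P /\ semi_decidable_RP (fun M => ~ P M).

(* Non-triviality has to be read among the marked groups with a given number k
   of generators: this number can be computed from a name, so that e.g. the set
   of marked groups of rank at most 1 is decidable, and it neither contains nor
   avoids all the recursively presented marked groups. *)
Definition nontrivial (k : nat) (P : marked_group -> Prop) : Prop :=
  (exists M, [/\ rank M = k, recursively_presented M & P M]) /\
  (exists M, [/\ rank M = k, recursively_presented M & ~ P M]).

(* Main.v *)
Require Import Defs.
From mathcomp Require Import all_boot.
From mathcomp Require Import boolp classical_sets.
From Stdlib Require Cantor.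

(** By Kleene's recursion theorem there is, for every semi-decidable P
    containing the free group on k generators and every j, an index e such that
    W e is W j if P contains the group named by <<k, e>>, and is empty otherwise.
    In the second case e names the free group, which is in P, a contradiction;
    so e names the same group as j, which is therefore in P. Hence a
    semi-decidable property containing the free group contains every recursively
    presented group of rank k, and this applies to P or to its complement. *)

Set Implicit Arguments.
Unset Strict Implicit.
Unset Printing Implicit Defensive.

(** On an index [k.+4] the recursive calls have arguments at most [k %/ 4], so fuel bounding the
    index never runs out. *)
Lemma decode_rec_fuel n f g : n <= f -> n <= g -> decode_rec f n = decode_rec g n.
Proof.
elim: f g n => [|f IH] [|g] [|[|[|[|n]]]] //=; rewrite !ltnS => lenf leng.
have le3 h : n.+3 <= h -> n %/ 4 <= h.
  by apply: leq_trans; rewrite (leq_trans (leq_div _ _)) // -addn3 leq_addr.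
have /andP[] := pair_ge (Cantor.of_nat (n %/ 4)).1 (Cantor.of_nat (n %/ 4)).2.
rewrite /pair_nat -surjective_pairing Cantor.cancel_to_of => le1 le2.
have lef := le3 _ lenf; have leg := le3 _ leng.
rewrite (IH g (n %/ 4)) // (IH g (Cantor.of_nat _).1) ?(leq_trans le1) //.
by rewrite (IH g (Cantor.of_nat _).2) ?(leq_trans le2).
Qed.

(** Makes indices of composite programs explicit numbers that programs can compute; the inverse of
    [decode] given by [decode_bij] is known only abstractly. *)
Lemma decode_pair a b r : r < 3 ->
  decode (<<a, b>> * 4 + r).+4 =
  match r with
  | 0 => Pair (decode a) (decode b)
  | 1 => Comp (decode a) (decode b)
  | _ => Rec (decode a) (decode b)
  end.
Proof.
move=> ltr; have /andP[lea leb] := pair_ge a b.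
have le3 : <<a, b>> <= (<<a, b>> * 4 + r).+3.
  by rewrite -addn3 -addnA (leq_trans _ (leq_addr _ _)) // leq_pmulr.
have fuel x : x <= <<a, b>> -> decode_rec (<<a, b>> * 4 + r).+3 x = decode x.
  by move=> lex; apply: decode_rec_fuel => //; apply: leq_trans le3.
have step f : decode_rec f.+1 (<<a, b>> * 4 + r).+4 =
    match r with
    | 0 => Pair (decode_rec f a) (decode_rec f b)
    | 1 => Comp (decode_rec f a) (decode_rec f b)
    | _ => Rec (decode_rec f a) (decode_rec f b)
    end.
  rewrite /= divnMDl // modnMDl divn_small ?modn_small ?(ltn_trans ltr) //.
  by rewrite addn0 pair_natK; case: r ltr {le3 fuel} => [|[|[|]]].
by rewrite {1}/decode step !fuel.
Qed.

Definition computes (c : code) (f : nat -> nat) : Prop :=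
  forall x y, eval c x y <-> y = f x.

Lemma computes_pair c d f g : computes c f -> computes d g ->
  computes (Pair c d) (fun x => <<f x, g x>>).
Proof.
move=> cf dg x y; split=> [[u [v [/cf-> /dg-> ->]]]|->] //.
by exists (f x), (g x); split=> //; [apply/cf|apply/dg].
Qed.

Lemma eval_comp c d f x y : computes d f -> eval (Comp c d) x y <-> eval c (f x) y.
Proof. by move=> df; split=> [[u /df->]|h] //; exists (f x) => //; apply/df. Qed.

Lemma computes_comp c d f g : computes c f -> computes d g ->
  computes (Comp c d) (fun x => f (g x)).
Proof. by move=> cf dg x y; rewrite (eval_comp c x y dg). Qed.

Lemma computes_rec c d f g : computes c f -> computes d g ->
  computes (Rec c d) (fun x =>
    let a := (Cantor.of_nat x).1 in
    nat_rect (fun=> nat) (f a) (fun m r => g <<a, <<m, r>>>>) (Cantor.of_nat x).2).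
Proof.
move=> cf dg x /=; elim: (Cantor.of_nat x).2 => [|m IH] y //=.
by split=> [[r /IH-> /dg]|->] //; eexists; [apply/IH|apply/dg].
Qed.

Lemma computes_eq c f g : computes c f -> f =1 g -> computes c g.
Proof. by move=> cf fg x y; rewrite -fg. Qed.

Lemma computes_id : computes (Pair Fst Snd) id.
Proof.
apply: computes_eq (computes_pair (f := fun x => _) (g := fun x => _) _ _) _;
  try by move=> x y; apply: iff_refl.
by move=> x /=; rewrite /pair_nat -surjective_pairing Cantor.cancel_to_of.
Qed.

(** An index of [Succ] composed [b] times onto [Zero]: 1 is the index of [Succ], and residue 1 marks
    [Comp]. *)
Fixpoint const_index (b : nat) : nat :=
  if b is b'.+1 then (<<1, const_index b'>> * 4 + 1).+4 else 0.

Lemma computes_const b : computes (decode (const_index b)) (fun=> b).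
Proof.
elim: b => [|b IH]; first by [].
by rewrite /= decode_pair //; apply: computes_comp IH.
Qed.

Lemma computable_const b : exists c, computes c (fun=> b).
Proof. by exists (decode (const_index b)); apply: computes_const. Qed.

Lemma computable_iter f c a : computes c f ->
  exists d, computes d (fun n => iter n f a).
Proof.
move=> cf; have [ca caP] := computable_const a.
have sndP : computes Snd (fun x => (Cantor.of_nat x).2) by [].
(* [Rec] recurses on the second component, so the input is paired with a dummy 0; [Comp Snd Snd]
   extracts the previous value [r] from [<<0, <<m, r>>>>]. *)
exists (Comp (Rec ca (Comp c (Comp Snd Snd))) (Pair Zero (Pair Fst Snd))).
apply: computes_eq.
  have zeroP : computes Zero (fun=> 0) by [].
  apply: computes_comp (computes_pair zeroP computes_id).
  apply: computes_rec caP _; apply: computes_comp cf _.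
  exact: (computes_comp sndP sndP).
by move=> n; rewrite pair_natK /=; elim: n => //= n ->; rewrite !pair_natK.
Qed.

Lemma computable_node r : exists c, computes c (fun m => (m * 4 + r).+4).
Proof.
have succP : computes Succ succn by [].
have s4P : computes (Comp (Comp Succ Succ) (Comp Succ Succ)) (fun x => x.+4).
  have s2P := computes_comp succP succP; exact: (computes_comp s2P s2P).
(* Adding 4 to [r.+4], [m] times, replaces a program for multiplication. *)
have [c cP] := computable_iter r.+4 s4P; exists c.
by apply: computes_eq cP _; elim=> //= n ->.
Qed.

Lemma computable_const_index : exists c, computes c const_index.
Proof.
have [one oneP] := computable_const 1; have [node nodeP] := computable_node 1.
have stepP := computes_comp nodeP (computes_pair oneP computes_id).
have [c cP] := computable_iter 0 stepP; exists c.
by apply: computes_eq cP _; elim=> //= n ->.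
Qed.

(* An index of [Pair Fst Snd], which computes the identity. *)
Definition id_index : nat := (<<2, 3>> * 4 + 0).+4.

(** Self-application by the s-m-n construction: an index of the program that runs [decode a] on [a]
    paired with its input. *)
Definition diag (a : nat) : nat :=
  (<<a, (<<const_index a, id_index>> * 4 + 0).+4>> * 4 + 1).+4.

Lemma eval_diag a x y : eval (decode (diag a)) x y <-> eval (decode a) <<a, x>> y.
Proof.
have -> : decode (diag a) =
    Comp (decode a) (Pair (decode (const_index a)) (Pair Fst Snd)).
  by rewrite /diag /id_index !decode_pair.
exact: eval_comp (computes_pair (computes_const a) computes_id).
Qed.

Lemma computable_diag : exists c, computes c diag.
Proof.
have [ci ciP] := computable_const_index.
have [ind indP] := computable_const id_index.
have [n0 n0P] := computable_node 0; have [n1 n1P] := computable_node 1.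
exists (Comp n1 (Pair (Pair Fst Snd) (Comp n0 (Pair ci ind)))).
apply: computes_comp n1P _; apply: computes_pair computes_id _.
exact: computes_comp n0P (computes_pair ciP indP).
Qed.

Theorem recursion_theorem c :
  exists e, forall x y, phi e x y <-> eval c <<e, x>> y.
Proof.
have [d dP] := computable_diag; have [index _ indexK] := decode_bij.
have fstP : computes Fst (fun x => (Cantor.of_nat x).1) by [].
have sndP : computes Snd (fun x => (Cantor.of_nat x).2) by [].
have argP := computes_pair (computes_comp dP fstP) sndP.
(* Let [a] be an index of the program that runs [c] on [<<diag b, x>>] when given [<<b, x>>]. For
   [b = a] this says that [diag a] runs [c] on [<<diag a, x>>]. *)
exists (diag (index (Comp c (Pair (Comp d Fst) Snd)))) => x y.
by rewrite /phi eval_diag indexK (eval_comp c _ y argP) pair_natK.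
Qed.

Lemma nu_RPE n i : nu_RP <<n, i>> = presentation (@theta n @` W i)%classic.
Proof. by rewrite /nu_RP pair_natK. Qed.

Lemma semi_decidable_RP_free P n j : semi_decidable_RP P ->
  P (presentation (@theta n @` set0)%classic) -> P (nu_RP <<n, j>>).
Proof.
move=> [i iP] Pfree; have [cn cnP] := computable_const n.
have fstP : computes Fst (fun x => (Cantor.of_nat x).1) by [].
have sndP : computes Snd (fun x => (Cantor.of_nat x).2) by [].
(* [Pair] halts only if both components do: the first tests P at the name [<<n, e>>], the second
   runs [decode j] on [x]. The output is irrelevant to [W e]. *)
have [e eP] := recursion_theorem
  (Pair (Comp (decode i) (Pair cn Fst)) (Comp (decode j) Snd)).
have We x : W e x <-> P (nu_RP <<n, e>>) /\ W j x.
  have iE u : eval (Comp (decode i) (Pair cn Fst)) <<e, x>> u <-> phi i <<n, e>> u.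
    by rewrite (eval_comp _ _ _ (computes_pair cnP fstP)) pair_natK.
  have jE v : eval (Comp (decode j) Snd) <<e, x>> v <-> phi j x v.
    by rewrite (eval_comp _ _ _ sndP) pair_natK.
  rewrite -iP; split=> [[y /eP[u [v [iu jv _]]]]|[[u iu] [v jv]]].
    by split; [exists u; apply/iE|exists v; apply/jE].
  by exists <<u, v>>; apply/eP; exists u, v; split=> //; [apply/iE|apply/jE].
have [Pe|nPe] := pselect (P (nu_RP <<n, e>>)).
  suff WeWj : W e = W j by move: Pe; rewrite !nu_RPE WeWj.
  by apply/seteqP; split=> x; [case/We|move=> Wx; apply/We].
have We0 : W e = set0 by apply/seteqP; split=> x; [case/We|case].
by case: nPe; rewrite nu_RPE We0.
Qed.

Lemma rank_iso M N : marked_iso M N -> rank M = rank N.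
Proof. by case=> f _ eqN; rewrite /rank -eqN size_map. Qed.

(** The first component of a name is the rank of the group named, and isomorphisms preserve the
    rank. *)
Lemma recursively_presented_name M : recursively_presented M ->
  exists j, marked_iso (nu_RP <<rank M, j>>) M.
Proof.
case=> p isoM; exists (Cantor.of_nat p).2; rewrite -(rank_iso isoM).
have -> : rank (nu_RP p) = (Cantor.of_nat p).1.
  by rewrite /nu_RP; case: (Cantor.of_nat p) => n i; rewrite /rank size_map size_enum_ord.
by rewrite /pair_nat -surjective_pairing Cantor.cancel_to_of.
Qed.

Theorem corollary5 (k : nat) :
  ~ exists P : marked_group -> Prop,
      [/\ marked_group_property P, nontrivial k P & decidable_RP P].
Proof.
move=> [P [isoP [[M [rkM /recursively_presented_name[i isoM] PM]]
  [N [rkN /recursively_presented_name[j isoN] nPN]]] [sdP sdnP]]].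
rewrite {}rkM in isoM; rewrite {}rkN in isoN.
(* If P contains the free group, the witness [N] is contradicted; otherwise the complement does, and
   [M] is. *)
have [Pfree|nPfree] := pselect (P (presentation (@theta k @` set0)%classic)).
  by apply: nPN; apply/(isoP _ _ isoN); apply: semi_decidable_RP_free sdP Pfree.
by apply: (semi_decidable_RP_free i sdnP nPfree); apply/(isoP _ _ isoM).
Qed.
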